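(* For $n\geq 2$, the number of permutations $\pi\in\mathcal{S}_n$ with at most one descent such that $\operatorname{des}(\pi^2)\leq 2$ equals $2F_{n+3}-\left\lfloor\frac{(n+4)^2}{4}\right\rfloor+1$, where $F_m$ denotes the Fibonacci numbers with $F_1=F_2=1$.
   Context: $\mathcal{S}_n$ is the symmetric group on $[n]$; a permutation $\pi=\pi_1\cdots\pi_n$ (one-line notation, $\pi_i=\pi(i)$) has a descent at $i\in[n-1]$ if $\pi_i>\pi_{i+1}$, and $\operatorname{des}(\pi)$ is the number of descents. $\pi^2(i)=\pi(\pi(i))$. *)

(* Defs.v *)
From mathcomp Require Import all_boot all_order all_fingroup all_algebra.

Set Implicit Arguments.
Unset Strict Implicit.
Unset Printing Implicit Defensive.

(* Positions and values are numbered from 0: the letter at position i of the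
   one-line notation of s is s i, and i is a descent when position i.+1 exists
   and carries a smaller letter. *)
Definition descent_set (n : nat) (s : 'S_n) : {set 'I_n} :=
  [set i : 'I_n | [exists j : 'I_n, (j == i.+1 :> nat) && (s j < s i)]].

Definition des (n : nat) (s : 'S_n) : nat := #|descent_set s|.

Fixpoint fib (m : nat) : nat :=
  match m with
  | 0 => 0
  | m'.+1 => match m' with 0 => 1 | m''.+1 => fib m' + fib m'' end
  end.

(* Main.v *)
(* A permutation s with at most one descent is increasing on the positions
   [0, k) and on [k, n) for some k, unique unless s = 1.  Then s^2 can only
   descend at k - 1, where the first run crosses the value k, and where the
   second run does.  Since s i >= i on the first run and s i <= i on the second,
   all three are descents unless every i < k with s i < k is fixed, or every
   i >= k with s i >= k is fixed.  A permutation of the first kind is determined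
   by k and the set of values >= k in its first run, an arbitrary subset of
   [k, n) with at most k elements; reversal exchanges the two kinds, and both hold
   iff that subset is an initial interval of [k, n).  It remains to sum
   #(first) + #(second) - #(both) over k: the sum over k of sum_(x <= k) C(n-k, x)
   is F_(n+3) - 1 and the sum of min(k, n-k) is floor(n^2/4). *)
Require Import Defs.
From mathcomp Require Import all_boot all_order all_fingroup all_algebra.
From mathcomp Require Import zify.

Set Implicit Arguments.
Unset Strict Implicit.
Unset Printing Implicit Defensive.

(** * Bijections of nat with two increasing runs *)

(** The disjunction puts [i] and [j] in the same run. Working on all of nat spares bounds on
    successors and preimages. *)
Definition shuffle (n k : nat) (f : nat -> nat) : Prop :=
  [/\ injective f,
      forall v, exists u, f u = v,
      forall i, n <= i -> f i = i &
      forall i j, i < j -> j < k \/ k <= i -> f i < f j].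

Definition lo_fixed (k : nat) (f : nat -> nat) : Prop :=
  forall i, i < k -> f i < k -> f i = i.

Definition hi_fixed (k : nat) (f : nat -> nat) : Prop :=
  forall i, k <= i -> k <= f i -> f i = i.

Lemma shuffle_lo n k f i : shuffle n k f -> i < k -> i <= f i.
Proof.
move=> [_ _ _ f_incr]; elim: i => // i IHi lt_ik.
have := f_incr i i.+1 (ltnSn i) (or_introl lt_ik); have := IHi (ltnW lt_ik); lia.
Qed.

(** Downward induction from the fixed tail: [f i < f i.+1 <= i.+1]. *)
Lemma shuffle_hi n k f i : shuffle n k f -> k <= i -> f i <= i.
Proof.
move=> [_ _ f_id f_incr]; have [m] := ubnP (n - i); elim: m i => // m IHm i ltm le_ki.
have [le_ni|lt_in] := leqP n i; first by rewrite f_id.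
have := f_incr i i.+1 (ltnSn i) (or_intror le_ki).
have := IHm i.+1; lia.
Qed.

(** On the first run [f i - i] is nonnegative and never decreases, so a zero forces zeros before
    it. *)
Lemma shuffle_lo_fixed n k f i j :
  shuffle n k f -> i <= j -> j < k -> f j = j -> f i = i.
Proof.
move=> fk; case: (fk) => [_ _ _ f_incr] le_ij lt_jk fj.
have [m def_j] : exists m, j = i + m by exists (j - i); lia.
elim: m j def_j le_ij lt_jk fj => [|m IHm] j def_j le_ij lt_jk fj.
  by move: fj; rewrite def_j addn0.
apply: (IHm (i + m)); try lia.
have := f_incr (i + m) j; have := @shuffle_lo _ _ _ (i + m) fk; lia.
Qed.

(** On the second run [i - f i] is nonnegative and never increases, so a zero forces zeros after
    it. *)
Lemma shuffle_hi_fixed n k f i j :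
  shuffle n k f -> i <= j -> k <= i -> f i = i -> f j = j.
Proof.
move=> fk; case: (fk) => [_ _ _ f_incr] le_ij le_ki fi.
have [m ->] : exists m, j = i + m by exists (j - i); lia.
elim: m => [|m IHm]; first by rewrite addn0.
have := f_incr (i + m) (i + m.+1); have := @shuffle_hi _ _ _ (i + m.+1) fk; lia.
Qed.

(* The values below f k, the least value of the second run, all come from the
   first run. *)
Lemma shuffle_id_below n k f i : shuffle n k f -> f k < k -> i < f k -> f i = i.
Proof.
move=> fk lt_fk; case: (fk) => [f_inj f_surj _ f_incr].
have [m] := ubnP i; elim: m i => // m IHm i ltm lt_i.
have [u fu] := f_surj i.
have lt_uk : u < k.
  rewrite ltnNge; apply/negP => le_ku.
  have [eq_uk|ne_uk] := eqVneq u k; first by move: fu; rewrite eq_uk; lia.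
  have := f_incr k u; lia.
have le_u := shuffle_lo fk lt_uk.
have [eq_ui|ne_u] := eqVneq u i; first by rewrite -{1}eq_ui.
have := IHm u; lia.
Qed.

(** Here [f k] is the greatest value of the first run, so larger values all come from the second
    run. *)
Lemma shuffle_id_above n k f i : shuffle n k.+1 f -> k < f k -> f k < i -> f i = i.
Proof.
move=> fk lt_fk; case: (fk) => [f_inj f_surj f_id f_incr].
have [m] := ubnP (n - i); elim: m i => // m IHm i ltm lt_i.
have [le_ni|lt_in] := leqP n i; first by rewrite f_id.
have [u fu] := f_surj i.
have lt_uk : k < u.
  rewrite ltnNge; apply/negP => le_uk.
  have [eq_uk|ne_uk] := eqVneq u k; first by move: fu; rewrite eq_uk; lia.
  have := f_incr u k; lia.
have le_u := shuffle_hi fk lt_uk.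
have [eq_ui|ne_u] := eqVneq u i; first by rewrite -{1}eq_ui.
have := IHm u; lia.
Qed.

(** * Possible and forced descents of the square *)

(** Inside a run [f i < f i.+1], and a second application of [f] can reverse these values only if
    [k] separates them. *)
Lemma descent_sq_cases n k f i : shuffle n k f -> f (f i.+1) < f (f i) ->
  [\/ i.+1 = k, i.+1 < k /\ f i < k <= f i.+1 | k <= i /\ f i < k <= f i.+1].
Proof.
move=> [_ _ _ f_incr] lt_ff.
have [eq_ik|ne_ik] := eqVneq i.+1 k; first by constructor 1.
have lt_f : f i < f i.+1 by apply: f_incr; lia.
have cross : f i < k <= f i.+1.
  by have := f_incr (f i) (f i.+1) lt_f; lia.
have [lt_ik|le_ki] := ltnP i k; first by constructor 2; split => //; lia.
by constructor 3.
Qed.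

Lemma crossing_lo_uniq n k f i j : shuffle n k f -> i.+1 < k -> j.+1 < k ->
  f i < k <= f i.+1 -> f j < k <= f j.+1 -> i = j.
Proof.
move=> [_ _ _ f_incr] lt_ik lt_jk ci cj.
have [lt_ij|lt_ji|//] := ltngtP i j.
  by have [eq_ij|ne_ij] := eqVneq i.+1 j; [subst j|have := f_incr i.+1 j]; lia.
by have [eq_ij|ne_ij] := eqVneq j.+1 i; [subst i|have := f_incr j.+1 i]; lia.
Qed.

Lemma crossing_hi_uniq n k f i j : shuffle n k f -> k <= i -> k <= j ->
  f i < k <= f i.+1 -> f j < k <= f j.+1 -> i = j.
Proof.
move=> [_ _ _ f_incr] le_ki le_kj ci cj.
have [lt_ij|lt_ji|//] := ltngtP i j.
  by have [eq_ij|ne_ij] := eqVneq i.+1 j; [subst j|have := f_incr i.+1 j]; lia.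
by have [eq_ij|ne_ij] := eqVneq j.+1 i; [subst i|have := f_incr j.+1 i]; lia.
Qed.

(** At a descent, [v = f (f i.+1)] would lie below the fixed point [i], hence be fixed; injectivity
    then gives [v = f i.+1], although [v < k <= f i.+1]. *)
Lemma lo_fixed_no_descent n k f i : shuffle n k f -> lo_fixed k f ->
  i.+1 < k -> f i < k <= f i.+1 -> f (f i) <= f (f i.+1).
Proof.
move=> fk f_lo lt_ik /andP[lt_fi le_fi]; case: (fk) => [f_inj _ _ f_incr].
have fi : f i = i by apply: f_lo; lia.
rewrite fi leqNgt fi; apply/negP => lt_ff.
have lt_vk : f (f i.+1) < k by lia.
have fv : f (f (f i.+1)) = f (f i.+1).
  by apply: (shuffle_lo_fixed (j := i) fk) => //; lia.
by have := f_inj _ _ fv; lia.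
Qed.

Lemma hi_fixed_no_descent n k f i : shuffle n k f -> hi_fixed k f ->
  k <= i -> f i < k <= f i.+1 -> f (f i) <= f (f i.+1).
Proof.
move=> fk f_hi le_ki /andP[lt_fi le_fi]; case: (fk) => [f_inj _ _ f_incr].
have fi : f i.+1 = i.+1 by apply: f_hi; lia.
rewrite fi leqNgt fi; apply/negP => lt_ff.
have fv : f (f (f i)) = f (f i).
  by apply: (shuffle_hi_fixed (i := i.+1) fk) => //; lia.
by have := f_inj _ _ fv; lia.
Qed.

(** Let [p] be the last first-run position with value below [k]. It is not fixed, so
    [p.+1 <= f p < k] and [f (f p.+1) <= f p.+1 <= f (f p)]; injectivity makes this strict. *)
Lemma not_lo_fixed_descent n k f : shuffle n k f -> ~ lo_fixed k f ->
  exists2 p, p.+1 < k & f p < k <= f p.+1 /\ f (f p.+1) < f (f p).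
Proof.
move=> fk nf_lo; case: (fk) => [f_inj f_surj f_id f_incr].
have [a [lt_ak lt_fak ne_fa]] : exists a, [/\ a < k, f a < k & f a != a].
  case: (boolP [exists a : 'I_k, (f a < k) && (f a != a)]).
    by case/existsP => a /andP[lt_fa ne_fa]; exists a.
  rewrite negb_exists => /forallP f_lo; case: nf_lo => i lt_ik lt_fi.
  by apply/eqP; have := f_lo (Ordinal lt_ik); rewrite /= lt_fi negbK.
have exP : exists p, (p < k) && (f p < k) by exists a; rewrite lt_ak.
have leP p : (p < k) && (f p < k) -> p <= k by lia.
case: (ex_maxnP exP leP) => p /andP[lt_pk lt_fpk] max_p.
have le_ap : a <= p by apply: max_p; rewrite lt_ak.
have ne_fp : f p != p.
  by apply: contra ne_fa => /eqP fp; apply/eqP; apply: (shuffle_lo_fixed fk le_ap).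
have le_pf := shuffle_lo fk lt_pk.
have lt_p1k : p.+1 < k by lia.
have le_kf : k <= f p.+1 by have := max_p p.+1; lia.
exists p; rewrite // lt_fpk le_kf; split => //.
have le_d : f (f p.+1) <= f p.+1 by apply: (shuffle_hi fk).
have le_c : f p.+1 <= f (f p).
  have [->//|ne_c] := eqVneq p.+1 (f p).
  by apply/ltnW/f_incr; lia.
have ne_ff : f (f p.+1) != f (f p) by apply/eqP => /f_inj; lia.
lia.
Qed.

(** Dually, let [q.+1] be the first second-run position with value at least [k]; then
    [f (f q.+1) <= f q <= f (f q)]. *)
Lemma not_hi_fixed_descent n k f : shuffle n k f -> ~ hi_fixed k f ->
  exists2 q, k <= q & f q < k <= f q.+1 /\ f (f q.+1) < f (f q).
Proof.
move=> fk nf_hi; case: (fk) => [f_inj f_surj f_id f_incr].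
have [b [le_kb le_kfb ne_fb]] : exists b, [/\ k <= b, k <= f b & f b != b].
  (* A search below [n] suffices, since later positions are fixed. *)
  case: (boolP [exists b : 'I_n, [&& k <= b, k <= f b & f b != b]]).
    by case/existsP => b /and3P[]; exists b.
  rewrite negb_exists => /forallP f_hi; case: nf_hi => i le_ki le_kfi.
  have [le_ni|lt_in] := leqP n i; first exact: f_id.
  by apply/eqP; have := f_hi (Ordinal lt_in); rewrite /= le_ki le_kfi negbK.
have exP : exists e, (k <= e) && (k <= f e) by exists b; rewrite le_kb.
case: (ex_minnP exP) => e /andP[le_ke le_kfe] min_e.
have le_eb : e <= b by apply: min_e; rewrite le_kb.
have ne_fe : f e != e.
  by apply: contra ne_fb => /eqP fe; apply/eqP; apply: (shuffle_hi_fixed fk le_eb).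
have le_fe := shuffle_hi fk le_ke.
have [q def_e] : exists q, e = q.+1 by exists e.-1; lia.
subst e; have le_kq : k <= q by lia.
have lt_fq : f q < k by have := min_e q; lia.
exists q; rewrite // lt_fq le_kfe; split => //.
have le_g : f q <= f (f q) by apply: (shuffle_lo fk).
have le_c : f (f q.+1) <= f q.
  have [->//|ne_c] := eqVneq (f q.+1) q.
  by apply/ltnW/f_incr; lia.
have ne_ff : f (f q.+1) != f (f q) by apply/eqP => /f_inj; lia.
lia.
Qed.

(** Without this descent, either [k < f (f k.+1)] or [f (f k) <= k]. In the first case every
    first-run position with value at most [k] lies below [f k.+1] and is fixed; in the second every
    second-run position with value above [k] lies above [f k] and is fixed. *)
Lemma not_fixed_descent_mid n k f : shuffle n k.+1 f -> k < f k -> f k.+1 < k.+1 ->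
  ~ lo_fixed k.+1 f -> ~ hi_fixed k.+1 f -> f (f k.+1) < f (f k).
Proof.
move=> fk lt_kf lt_fk nf_lo nf_hi; case: (fk) => [f_inj f_surj f_id f_incr].
have ne_ff : f (f k.+1) != f (f k) by apply/eqP => /f_inj; lia.
rewrite ltnNge; apply/negP => le_ff.
have [le_kg|lt_gk] := leqP k.+1 (f (f k.+1)).
  case: nf_lo => a lt_ak lt_fak; apply: (shuffle_id_below fk) => //.
  rewrite ltnNge; apply/negP => le_ga.
  have [eq_ga|ne_ga] := eqVneq (f k.+1) a; first by move: le_kg; rewrite eq_ga; lia.
  have := f_incr (f k.+1) a; lia.
case: nf_hi => b le_kb le_kfb; apply: (shuffle_id_above fk) => //.
rewrite ltnNge; apply/negP => le_bd.
have [eq_bd|ne_bd] := eqVneq b (f k); first by move: le_kfb; rewrite eq_bd; lia.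
have := f_incr b (f k); lia.
Qed.

(** * From permutations to shuffles *)

(* Extending s by the identity to all of nat turns "no letter at position n"
   into an ordinary ascent. *)
Definition perm_nat (n : nat) (s : 'S_n) (i : nat) : nat :=
  if insub i is Some j then val (s j) else i.

Definition cut (n k : nat) (s : 'S_n) : bool :=
  [forall i : 'I_n, forall j : 'I_n,
     (i < j) && ((j < k) || (k <= i)) ==> (s i < s j)].

Definition lo (n k : nat) (s : 'S_n) : bool :=
  [forall i : 'I_n, (i < k) && (s i < k) ==> (s i == i)].

Definition hi (n k : nat) (s : 'S_n) : bool :=
  [forall i : 'I_n, (k <= i) && (k <= s i) ==> (s i == i)].

Lemma cutP n k (s : 'S_n) :
  reflect (forall i j : 'I_n, i < j -> (j < k) || (k <= i) -> s i < s j) (cut k s).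
Proof.
apply: (iffP forallP) => [cut_s i j lt_ij ijk | cut_s i].
  by have /forallP/(_ j)/implyP-> := cut_s i; rewrite ?lt_ij.
by apply/forallP => j; apply/implyP => /andP[lt_ij]; apply: cut_s.
Qed.

Lemma perm_natE n (s : 'S_n) (i : 'I_n) : perm_nat s i = s i.
Proof. by rewrite /perm_nat valK. Qed.

Lemma perm_nat_id n (s : 'S_n) i : n <= i -> perm_nat s i = i.
Proof. by move=> le_ni; rewrite /perm_nat insubF // ltnNge le_ni. Qed.

Lemma perm_nat_ge n (s : 'S_n) i : (n <= perm_nat s i) = (n <= i).
Proof.
have [le_ni|lt_in] := leqP n i; first by rewrite perm_nat_id.
by rewrite -[i]/(val (Ordinal lt_in)) perm_natE leqNgt ltn_ord.
Qed.

Lemma perm_natM n (s t : 'S_n) i : perm_nat (s * t)%g i = perm_nat t (perm_nat s i).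
Proof.
have [le_ni|lt_in] := leqP n i; first by rewrite !perm_nat_id.
by rewrite -[i]/(val (Ordinal lt_in)) !perm_natE permM.
Qed.

Lemma perm_natK n (s : 'S_n) : cancel (perm_nat s) (perm_nat s^-1%g).
Proof.
move=> i; rewrite -perm_natM mulgV.
have [le_ni|lt_in] := leqP n i; first by rewrite perm_nat_id.
by rewrite -[i]/(val (Ordinal lt_in)) perm_natE perm1.
Qed.

Lemma shuffle_cut n k (s : 'S_n) : k <= n -> cut k s -> shuffle n k (perm_nat s).
Proof.
move=> le_kn /cutP cut_s; split.
- exact: can_inj (perm_natK s).
- by move=> v; exists (perm_nat s^-1%g v); rewrite -{1}(invgK s) perm_natK.
- exact: perm_nat_id.
move=> i j lt_ij ijk; have [le_nj|lt_jn] := leqP n j.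
  rewrite (perm_nat_id _ le_nj); have [le_ni|lt_in] := leqP n i.
    by rewrite perm_nat_id.
  by apply: leq_trans le_nj; rewrite ltnNge perm_nat_ge -ltnNge.
have lt_in := ltn_trans lt_ij lt_jn.
rewrite -[i]/(val (Ordinal lt_in)) -[j]/(val (Ordinal lt_jn)) !perm_natE.
by apply: cut_s => //=; apply/orP.
Qed.

Lemma loP n k (s : 'S_n) : k <= n -> reflect (lo_fixed k (perm_nat s)) (lo k s).
Proof.
move=> le_kn; apply: (iffP forallP) => [lo_s i lt_ik | lo_s i].
  have lt_in := leq_trans lt_ik le_kn.
  rewrite -[i]/(val (Ordinal lt_in)) !perm_natE => lt_sk.
  by have /implyP/(_ _)/eqP-> := lo_s (Ordinal lt_in) => //=; rewrite lt_ik.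
apply/implyP => /andP[lt_ik lt_sk]; rewrite -val_eqE /= -perm_natE; apply/eqP.
by apply: lo_s; rewrite ?perm_natE.
Qed.

Lemma hiP n k (s : 'S_n) : reflect (hi_fixed k (perm_nat s)) (hi k s).
Proof.
apply: (iffP forallP) => [hi_s i le_ki | hi_s i].
  have [le_ni|lt_in] := leqP n i; first by rewrite perm_nat_id.
  rewrite -[i]/(val (Ordinal lt_in)) !perm_natE => le_ks.
  by have /implyP/(_ _)/eqP-> := hi_s (Ordinal lt_in) => //=; rewrite le_ki.
apply/implyP => /andP[le_ki le_ks]; rewrite -val_eqE /= -perm_natE; apply/eqP.
by apply: hi_s; rewrite ?perm_natE.
Qed.

Lemma mem_descent_set n (s : 'S_n) (i : 'I_n) :
  (i \in descent_set s) = (perm_nat s i.+1 < perm_nat s i).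
Proof.
rewrite inE perm_natE; apply/existsP/idP => [[j /andP[/eqP <-]] | lt_s].
  by rewrite perm_natE.
have lt_i1n : i.+1 < n.
  by rewrite ltnNge -(perm_nat_ge s) -ltnNge (ltn_trans lt_s).
by exists (Ordinal lt_i1n); rewrite eqxx /= -perm_natE.
Qed.

Lemma mem_descent_sq n (s : 'S_n) (i : 'I_n) : (i \in descent_set (s ^+ 2)%g) =
  (perm_nat s (perm_nat s i.+1) < perm_nat s (perm_nat s i)).
Proof. by rewrite mem_descent_set expgS expg1 !perm_natM. Qed.

(** * The descent criterion and the existence of a cut *)

Lemma des_sq_le2 n k (s : 'S_n) : k <= n -> cut k s ->
  (des (s ^+ 2)%g <= 2) = lo k s || hi k s.
Proof.
move=> le_kn cut_s; have fk := shuffle_cut le_kn cut_s.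
rewrite leqNgt; apply/idP/idP; last first.
  move=> lo_hi; apply/card_gt2P => -[x [y [z [[xD yD zD] [xy yz zx]]]]].
  (* [lo] rules out the crossing in the first run; if [lo] fails then [hi] holds and rules out the
     one in the second. *)
  have cases (i : 'I_n) : i \in descent_set (s ^+ 2)%g -> i.+1 = k \/
     if lo k s then k <= i /\ perm_nat s i < k <= perm_nat s i.+1
     else i.+1 < k /\ perm_nat s i < k <= perm_nat s i.+1.
    rewrite mem_descent_sq => lt_ff.
    case: (descent_sq_cases fk lt_ff) => [->|[lt_ik c]|[le_ki c]]; first by left.
      right; case: loP => // f_lo.
      by have := lo_fixed_no_descent fk f_lo lt_ik c; lia.
    right; case: ifP => // nlo; move: lo_hi; rewrite nlo => /hiP f_hi.
    by have := hi_fixed_no_descent fk f_hi le_ki c; lia.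
  have eq_cross (i j : 'I_n) : i.+1 != k -> j.+1 != k ->
    i \in descent_set (s ^+ 2)%g -> j \in descent_set (s ^+ 2)%g -> i = j.
    move=> ne_i ne_j /cases[|ci] /=; first lia; move=> /cases[|cj]; first lia.
    apply: val_inj => /=; move: ci cj.
    by case: ifP => _ [ki ci] [kj cj];
      [apply: (crossing_hi_uniq fk ki kj)|apply: (crossing_lo_uniq fk ki kj)].
  (* At most one of three distinct descents is at [k - 1]; the other two are the same crossing. *)
  have [xk|nxk] := eqVneq x.+1 k; last have [yk|nyk] := eqVneq y.+1 k.
  - have nyk : y.+1 != k by rewrite -xk eqSS eq_sym.
    have nzk : z.+1 != k by rewrite -xk eqSS.
    by move/eqP: yz; apply; apply: eq_cross.
  - have nzk : z.+1 != k by rewrite -yk eqSS eq_sym.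
    by move/eqP: zx; apply; apply: eq_cross.
  - by move/eqP: xy; apply; apply: eq_cross.
apply: contraR; rewrite negb_or => /andP[/(loP _ le_kn) nlo /hiP nhi].
have [p lt_pk [cp dp]] := not_lo_fixed_descent fk nlo.
have [q le_kq [cq dq]] := not_hi_fixed_descent fk nhi.
case: (fk) => [f_inj f_surj f_id f_incr].
(* Since [p.+1 < k], the cut is positive; after renaming it is [k.+1], and the middle descent is at
   [k]. *)
case: k le_kn {cut_s} fk nlo nhi lt_pk cp le_kq cq f_incr => // k le_kn.
move=> fk nlo nhi lt_pk cp le_kq cq f_incr.
have dk : perm_nat s (perm_nat s k.+1) < perm_nat s (perm_nat s k).
  apply: (not_fixed_descent_mid fk) => //.
    have [<-|ne] := eqVneq p.+1 k; first lia.
    by have := f_incr p.+1 k; lia.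
  have [->|ne] := eqVneq k.+1 q; first lia.
  by have := f_incr k.+1 q; lia.
(* Positions from [n] on are fixed, whereas [q] lies past the cut and its value before it. *)
have lt_qn : q < n.
  by rewrite ltnNge; apply/negP => le_nq; move: cq; rewrite f_id //; lia.
have lt_pn : p < n by lia.
have lt_kn : k < n by lia.
apply/card_gt2P; exists (Ordinal lt_pn), (Ordinal lt_kn), (Ordinal lt_qn).
by rewrite !mem_descent_sq -!val_eqE /=; split; split => //; lia.
Qed.

Lemma cut_des_le1 n k (s : 'S_n) : k <= n -> cut k s -> des s <= 1.
Proof.
move=> le_kn /(shuffle_cut le_kn) [_ _ _ f_incr].
rewrite leqNgt; apply/negP => /card_gt1P[x [y [xD yD /eqP ne_xy]]].
have cutpoint (i : 'I_n) : i \in descent_set s -> i.+1 = k.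
  rewrite mem_descent_set => lt_s; apply/eqP; apply: contraTT lt_s => ne_ik.
  by rewrite -leqNgt ltnW // f_incr; lia.
by apply/ne_xy/val_inj; have := cutpoint x xD; have := cutpoint y yD => /=; lia.
Qed.

Lemma des_le1_cut n (s : 'S_n) : des s <= 1 -> exists2 k, k <= n & cut k s.
Proof.
move=> des_s.
have [k le_kn desc_k] : exists2 k, k <= n &
    forall i : 'I_n, i \in descent_set s -> i.+1 = k.
  (* Cut just after the descent; if there is none, cut at [0]. *)
  have [->|[i iD]] := set_0Vmem (descent_set s); first by exists 0 => // i; rewrite inE.
  exists i.+1 => // j jD; congr _.+1.
  by have /card_le1P/(_ i iD j) := des_s; rewrite jD => /esym/eqP->.
exists k => //; apply/cutP => i j lt_ij ijk.
have [m def_j] : exists m, j = i + m.+1 :> nat by exists (j - i).-1; lia.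
rewrite -!perm_natE def_j; have : i + m.+1 < n by rewrite -def_j.
have : (i + m.+1 < k) || (k <= i) by rewrite -def_j.
clear - desc_k; elim: m => [|m IHm] ijk lt_n.
  have := desc_k i; rewrite mem_descent_set; rewrite addn1 in ijk *.
  have ne : perm_nat s i.+1 <> perm_nat s i by move/(can_inj (perm_natK s)); lia.
  lia.
have lt_mn : i + m.+1 < n by lia.
have := desc_k (Ordinal lt_mn); rewrite mem_descent_set /= -addnS.
have ne : perm_nat s (i + m.+2) <> perm_nat s (i + m.+1).
  by move/(can_inj (perm_natK s)); lia.
have := IHm; lia.
Qed.

(** * Counting the first kind by subsets of [[k, n)] *)

Lemma card_ord_lt n k : k <= n -> #|[set i : 'I_n | i < k]| = k.
Proof.
move=> le_kn; have inj_w : injective (widen_ord le_kn).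
  by move=> i j [eq_ij]; apply: val_inj.
rewrite -[RHS]card_ord -(card_imset _ inj_w).
apply: eq_card => i; rewrite inE; apply/idP/imsetP => [lt_ik | [j _ ->]].
  by exists (Ordinal lt_ik) => //; apply: val_inj.
exact: (ltn_ord j).
Qed.

(** A member [v] brings [[0, v]] into [S], and a non-member confines [S] to [[0, v)]; compare
    sizes. *)
Lemma mem_down_closed n (S : {set 'I_n}) (v : 'I_n) :
  (forall u w : 'I_n, u < w -> w \in S -> u \in S) -> (v \in S) = (v < #|S|).
Proof.
move=> S_down; apply/idP/idP => [vS|].
  rewrite -[v.+1](@card_ord_lt n) //; apply/subset_leq_card/subsetP => u.
  rewrite inE ltnS leq_eqVlt => /orP[/eqP/val_inj->//|lt_uv]; exact: S_down vS.
apply: contraTT => vNS; rewrite -leqNgt -[leqRHS](card_ord_lt (ltnW (ltn_ord v))).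
apply/subset_leq_card/subsetP => u uS; rewrite inE ltnNge leq_eqVlt.
apply: contra vNS => /orP[/eqP/val_inj->//|lt_vu]; exact: S_down uS.
Qed.

Definition first_run (n k : nat) (s : 'S_n) : {set 'I_n} := s @: [set i : 'I_n | i < k].

Lemma mem_first_run n k (s : 'S_n) i : (s i \in first_run k s) = (i < k).
Proof. by rewrite (mem_imset _ _ perm_inj) inE. Qed.

(** The two runs list [first_run] and its complement in increasing order. *)
Lemma cut_inj n k (s t : 'S_n) : cut k s -> cut k t -> first_run k s = first_run k t -> s = t.
Proof.
move=> cut_s cut_t eq_run; apply/permP => i.
have [m] := ubnP (i : nat); elim: m i => // m IHm i ltm; apply/val_inj/eqP.
(* The value [s' i] sits in [t'] at some [u] of the same run as [i]. Agreement on earlier positions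
   excludes [u < i], so [t' i <= t' u]. Exchanging the roles gives equality. *)
have le_st (s' t' : 'S_n) : cut k t' -> first_run k s' = first_run k t' ->
    (forall j : 'I_n, j < m -> s' j = t' j) -> t' i <= s' i.
  move=> /cutP cut_t' eq_run' IH.
  have def_u : s' i = t' (t'^-1%g (s' i)) by rewrite permKV.
  move: (t'^-1%g (s' i)) def_u => u def_u.
  have same : (u < k) = (i < k) by rewrite -(mem_first_run k t') -def_u -eq_run' mem_first_run.
  have [lt_ui|lt_iu|/val_inj eq_ui] := ltngtP u i; last by rewrite def_u eq_ui.
    have /perm_inj eq_ui : s' u = s' i by rewrite IH //; lia.
    by move: lt_ui; rewrite eq_ui ltnn.
  by rewrite def_u ltnW // cut_t' //; lia.
by rewrite eqn_leq !le_st // => j lt_jm; rewrite IHm.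
Qed.

(** List [A] increasingly, then its complement. *)
Lemma cut_exists n (A : {set 'I_n}) : exists2 s : 'S_n, cut #|A| s & first_run #|A| s = A.
Proof.
pose e := enum A ++ enum (~: A).
have size_e : size e = n by rewrite size_cat -!cardE cardsC card_ord.
have uniq_e : uniq e.
  rewrite cat_uniq !enum_uniq andbT /=; apply/hasPn => x.
  by rewrite !mem_enum inE.
have inj_e : injective (tnth (in_tuple e) \o cast_ord (esym size_e)).
  apply: inj_comp (@cast_ord_inj _ _ _).
  by apply/tuple_uniqP; rewrite /in_tuple.
pose s := perm inj_e.
have sE i : s i = nth i e i by rewrite permE /= (tnth_nth i).
have sorted_enum (B : {set 'I_n}) : sorted (fun i j : 'I_n => i < j) (enum B).
  rewrite /enum_mem; apply: sorted_filter; first by move=> x y z; apply: ltn_trans.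
  by have := iota_ltn_sorted 0 n; rewrite -val_enum_ord sorted_map enumT.
have tr : transitive (fun i j : 'I_n => i < j) by move=> x y z; apply: ltn_trans.
have sizeA : size (enum A) = #|A| by rewrite -cardE.
have sizeC : size (enum (~: A)) = n - #|A| by rewrite -cardE cardsCs setCK card_ord.
exists s.
  (* [sE] reads position [j] with default [j]; the default is changed to [i] so that both reads
     agree. *)
  apply/cutP => i j lt_ij ijk; rewrite !sE (set_nth_default i j) ?size_e //.
  rewrite !nth_cat sizeA.
  have [lt_jA|le_Aj] := ltnP j #|A|.
    rewrite (ltn_trans lt_ij lt_jA).
    by apply: (sorted_ltn_nth tr i (sorted_enum A)); rewrite ?inE ?sizeA //; lia.
  have le_Ai : #|A| <= i by lia.
  have -> : (i < #|A|) = false by lia.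
  apply: (sorted_ltn_nth tr i (sorted_enum (~: A))); rewrite ?inE ?sizeC;
  have := ltn_ord i; have := ltn_ord j; lia.
apply/setP => v; rewrite -[v](permKV s) mem_first_run; set i := (s^-1%g v).
rewrite sE nth_cat sizeA; have [lt_iA|le_Ai] := ltnP i #|A|.
  by rewrite -mem_enum mem_nth ?sizeA.
apply/esym/negbTE; rewrite -in_setC -mem_enum mem_nth // sizeC.
have := ltn_ord i; lia.
Qed.

(** The subset of [[k, n)] that encodes a permutation of the first kind. *)
Definition exceed (n k : nat) (s : 'S_n) : {set 'I_n} := [set v in first_run k s | k <= v].

(** Values below [k] in the first run are fixed points, and positions before a fixed point are again
    fixed by [lo]. These values thus form an initial segment, of size [k] minus that of [exceed]. *)
Lemma first_run_lo n k (s : 'S_n) : k <= n -> cut k s -> lo k s ->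
  first_run k s = [set v : 'I_n | v < k - #|exceed k s|] :|: exceed k s.
Proof.
move=> le_kn /cutP cut_s /forallP lo_s.
have lo_fix (i : 'I_n) : i < k -> s i < k -> s i = i.
  by move=> lt_ik lt_sk; apply/eqP; have /implyP-> := lo_s i; rewrite ?lt_ik.
pose low := [set v in first_run k s | v < k].
have split_run : first_run k s = low :|: exceed k s.
  by apply/setP => v; rewrite !inE -andb_orr; case: ltnP; rewrite andbT.
have card_low : #|low| = k - #|exceed k s|.
  have : #|first_run k s| = k by rewrite (card_imset _ perm_inj) card_ord_lt.
  have low_dis : low :&: exceed k s = set0.
    by apply/setP => v; rewrite !inE; case: ltnP; rewrite ?andbF.
  by rewrite {1}split_run cardsU low_dis cards0; lia.
rewrite {1}split_run -card_low; congr (_ :|: _).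
apply/setP => v; rewrite [RHS]inE; apply: mem_down_closed => u w lt_uw.
rewrite inE => /andP[/imsetP[x]]; rewrite !inE => lt_xk def_w; subst w => lt_sxk.
have eq_x := lo_fix x lt_xk lt_sxk; rewrite eq_x in lt_uw lt_sxk.
have lt_uk : u < k by lia.
have lt_su : s u < s x by apply: cut_s; rewrite ?lt_xk.
have su : s u = u by apply: lo_fix; rewrite // (ltn_trans lt_su) // eq_x.
by rewrite lt_uk andbT -su mem_first_run.
Qed.

Lemma exceed_inj n k : k <= n -> {in [pred s : 'S_n | cut k s && lo k s] &,
  injective (@exceed n k)}.
Proof.
move=> le_kn s t /andP[cut_s lo_s] /andP[cut_t lo_t] eq_st.
by apply: (cut_inj cut_s cut_t); rewrite !first_run_lo // eq_st.
Qed.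

(** Fill [B] up to [k] elements with the smallest values and take the permutation with that first
    run. A small value [v] sits at a position at most [v]; by induction an earlier position holds
    its own value, so [v] is fixed. *)
Lemma exceed_surj n k (B : {set 'I_n}) : k <= n -> #|B| <= k ->
  (forall v, v \in B -> k <= v) ->
  exists s : 'S_n, [/\ cut k s, lo k s & exceed k s = B].
Proof.
move=> le_kn le_Bk B_ge; pose A := [set v : 'I_n | v < k - #|B|] :|: B.
have cardA : #|A| = k.
  have le_n : k - #|B| <= n by lia.
  rewrite cardsU (card_ord_lt le_n).
  have -> : [set v : 'I_n | v < k - #|B|] :&: B = set0.
    by apply/setP => v; rewrite !inE; apply/negP => /andP[lt_v /B_ge]; lia.
  by rewrite cards0 subn0 subnK.
have [s] := cut_exists A; rewrite cardA => cut_s run_s; exists s.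
have fk := shuffle_cut le_kn cut_s.
have low_fix : forall v : 'I_n, v < k - #|B| -> s v = v.
  move=> v; have [m] := ubnP (v : nat); elim: m v => // m IHm v ltm lt_v.
  have : v \in first_run k s by rewrite run_s !inE lt_v.
  case/imsetP => u; rewrite inE => lt_uk def_v.
  have := shuffle_lo fk lt_uk; rewrite perm_natE -def_v leq_eqVlt.
  case/orP=> [/eqP/val_inj eq_uv|lt_uv]; first by rewrite -{1}eq_uv -def_v.
  have su : s u = u by apply: IHm; lia.
  by move: lt_uv; rewrite def_v su ltnn.
split=> //; last first.
  rewrite /exceed run_s; apply/setP => v; rewrite !inE.
  case vB: (v \in B); first by rewrite orbT B_ge.
  by rewrite orbF; lia.
apply/forallP => i; apply/implyP => /andP[lt_ik lt_sk].
have : s i \in A by rewrite -run_s mem_first_run.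
rewrite !inE => /orP[/low_fix/perm_inj/eqP//|/B_ge]; lia.
Qed.

Lemma card_subset_le (T : finType) (D : {set T}) k :
  #|[set B : {set T} | B \subset D & #|B| <= k]| = \sum_(x < k.+1) 'C(#|D|, x).
Proof.
under eq_bigr do rewrite -cards_draws.
rewrite -sum1_card (partition_big (fun B : {set T} => inord #|B| : 'I_k.+1) predT) //=.
apply: eq_bigr => x _; rewrite -sum1_card; apply: eq_bigl => B; rewrite !inE.
case: (B \subset D) => //=; apply/andP/eqP => [[le_B /eqP <-]|eq_Bx].
  by rewrite inordK.
by rewrite eq_Bx -ltnS ltn_ord; split => //; apply/eqP/val_inj; rewrite /= inordK.
Qed.

Lemma card_cut_lo n k : k <= n ->
  #|[set s : 'S_n | cut k s && lo k s]| = \sum_(x < k.+1) 'C(n - k, x).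
Proof.
move=> le_kn; pose D := ~: [set i : 'I_n | i < k].
have <- : #|D| = n - k by rewrite cardsCs setCK card_ord card_ord_lt.
rewrite -card_subset_le -(card_in_imset (f := @exceed n k)); last first.
  by move=> s t; rewrite !inE; apply: exceed_inj.
apply: eq_card => B; rewrite inE; apply/imsetP/andP => [[s]|[/subsetP BD le_B]].
  rewrite inE => /andP[cut_s lo_s ->]; split.
    by apply/subsetP => v; rewrite !inE -leqNgt => /andP[].
  rewrite -[leqRHS](card_ord_lt le_kn) -(card_imset [set i : 'I_n | i < k] (@perm_inj _ s)).
  by apply/subset_leq_card/subsetP => v; rewrite !inE => /andP[].
have [v /BD|s [cut_s lo_s <-]] := exceed_surj le_kn le_B.
  by rewrite !inE -leqNgt.
by exists s; rewrite // inE cut_s.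
Qed.

(** * Counting the permutations of both kinds *)

(** Were [u] a value of the second run, [hi] would make it a fixed point; then [w > u] would be
    fixed too and could not be in the first run. *)
Lemma exceed_hi_down n k (s : 'S_n) (u w : 'I_n) : k <= n -> cut k s -> hi k s ->
  k <= u -> u < w -> w \in exceed k s -> u \in exceed k s.
Proof.
move=> le_kn cut_s /hiP hi_s le_ku lt_uw; rewrite !inE le_ku andbT => /andP[w_run le_kw].
have fk := shuffle_cut le_kn cut_s.
rewrite -[u](permKV s) mem_first_run; set b := (s^-1%g u).
rewrite ltnNge; apply/negP => le_kb.
have sb : s b = u by rewrite permKV.
have fb : perm_nat s u = u.
  by have := hi_s b le_kb; rewrite perm_natE sb => /(_ le_ku) eq_ub; rewrite {1}eq_ub perm_natE sb.
have := shuffle_hi_fixed fk (ltnW lt_uw) le_ku fb; rewrite perm_natE => /val_inj sw.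
by move: w_run; rewrite -[w]sw mem_first_run; lia.
Qed.

Definition ord_itv (n k m : nat) : {set 'I_n} := [set v : 'I_n | k <= v < k + m].

Lemma card_ord_itv n k m : k + m <= n -> #|ord_itv n k m| = m.
Proof.
move=> le_kmn; have le_kn : k <= n by lia.
have -> : ord_itv n k m = [set v : 'I_n | v < k + m] :\: [set v : 'I_n | v < k].
  by apply/setP => v; rewrite !inE -leqNgt.
rewrite cardsD card_ord_lt // (setIidPr _) ?card_ord_lt ?addKn //.
by apply/subsetP => v; rewrite !inE; lia.
Qed.

Lemma exceed_hi n k (s : 'S_n) : k <= n -> cut k s -> hi k s ->
  exceed k s = ord_itv n k #|exceed k s|.
Proof.
move=> le_kn cut_s hi_s; set B := exceed k s.
(* Adding [[0, k)] turns the interval into an initial segment. *)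
pose S := [set v : 'I_n | v < k] :|: B.
have dis : [set v : 'I_n | v < k] :&: B = set0.
  by apply/setP => v; rewrite !inE; case: (ltnP v k); rewrite ?andbF.
have cardS : #|S| = k + #|B| by rewrite cardsU dis cards0 subn0 card_ord_lt.
have memS (v : 'I_n) : (v \in S) = (v < #|S|).
  apply: mem_down_closed => u w lt_uw; rewrite !inE.
  have [//|le_ku] := ltnP u k; have le_kw : k <= w by lia.
  have := exceed_hi_down le_kn cut_s hi_s le_ku lt_uw.
  by rewrite ltnNge !inE le_ku le_kw.
apply/setP => v; have := memS v; rewrite cardS !inE.
by have [|le_kv] := ltnP v k; rewrite ?andbF ?andbT //= => ->.
Qed.

(** Values from [k + m] on lie in the second run, at positions no smaller than themselves; downward
    induction shows them fixed. A second-run value that is at least [k] is one of these. *)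
Lemma hi_exceed_itv n k m (s : 'S_n) : k <= n -> cut k s -> exceed k s = ord_itv n k m -> hi k s.
Proof.
move=> le_kn cut_s eq_B; have fk := shuffle_cut le_kn cut_s.
have not_run (v : 'I_n) : k + m <= v -> v \notin first_run k s.
  move=> le_v; have : v \notin exceed k s by rewrite eq_B inE; lia.
  by rewrite inE (leq_trans _ le_v) ?leq_addr ?andbT.
have up_fix (v : 'I_n) : k + m <= v -> s v = v.
  have [d] := ubnP (n - v); elim: d v => // d IHd v ltd le_v.
  have := not_run v le_v; rewrite -{1}[v](permKV s) mem_first_run -leqNgt.
  have : s (s^-1%g v) = v by rewrite permKV.
  move: (s^-1%g v) => b sb le_kb.
  have := shuffle_hi fk le_kb; rewrite perm_natE sb leq_eqVlt.
  case/orP=> [/eqP/val_inj eq_vb|lt_vb]; first by rewrite {1}eq_vb.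
  have /(congr1 val) /= : s b = b by apply: IHd; have := ltn_ord b; lia.
  by rewrite sb; lia.
apply/forallP => i; apply/implyP => /andP[le_ki le_ks].
have : s i \notin exceed k s by rewrite inE mem_first_run ltnNge le_ki.
rewrite eq_B inE le_ks -leqNgt => /up_fix/perm_inj ->; exact: eqxx.
Qed.

(** The intervals starting at [k] are indexed by their length, at most [k] by the size of the first
    run and at most [n - k] by the room left. *)
Lemma card_cut_lo_hi n k : k <= n ->
  #|[set s : 'S_n | [&& cut k s, lo k s & hi k s]]| = (minn k (n - k)).+1.
Proof.
move=> le_kn; rewrite -(card_in_imset (f := @exceed n k)); last first.
  move=> s t; rewrite !inE => /and3P[cut_s lo_s _] /and3P[cut_t lo_t _].
  by apply: exceed_inj; rewrite // inE ?cut_s ?cut_t.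
rewrite -[RHS]card_ord.
rewrite -(card_imset (f := fun m : 'I__ => ord_itv n k m)); last first.
  move=> m m' eq_mm; apply: val_inj => /=.
  have le_m (i : 'I_(minn k (n - k)).+1) : k + i <= n by have := ltn_ord i; lia.
  by rewrite -(card_ord_itv (le_m m)) eq_mm card_ord_itv.
apply: eq_card => B; apply/imsetP/imsetP => [[s]|[m _ ->]].
  rewrite inE => /and3P[cut_s lo_s hi_s] ->.
  have le_Bk : #|exceed k s| <= k.
    rewrite -[leqRHS](card_ord_lt le_kn) -(card_imset [set i : 'I_n | i < k] (@perm_inj _ s)).
    by apply/subset_leq_card/subsetP => v; rewrite !inE => /andP[].
  have le_Bn : #|exceed k s| <= n - k.
    rewrite -[leqRHS](@card_ord_itv n k); last lia.
    by apply/subset_leq_card/subsetP => v; rewrite !inE subnKC // ltn_ord => /andP[_ ->].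
  have lt_B : #|exceed k s| < (minn k (n - k)).+1 by rewrite ltnS leq_min le_Bk.
  by exists (Ordinal lt_B); rewrite //= -exceed_hi.
have := ltn_ord m; rewrite ltnS leq_min => /andP[le_mk le_mn].
have card_m : #|ord_itv n k m| = m by rewrite card_ord_itv //; lia.
have [||s [cut_s lo_s eq_s]] := @exceed_surj n k (ord_itv n k m) le_kn.
- by rewrite card_m.
- by move=> v; rewrite inE => /andP[].
by exists s; rewrite // inE cut_s lo_s (hi_exceed_itv le_kn cut_s eq_s).
Qed.

(** * Reversal and the count of the second kind *)

(** Conjugation by it reverses both positions and values, so it exchanges the two runs, and [lo]
    with [hi]. *)
Definition rev_perm (n : nat) : 'S_n := perm (@rev_ord_inj n).

Lemma rev_permJE n (s : 'S_n) i : (s ^ rev_perm n)%g (rev_ord i) = rev_ord (s i).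
Proof. by rewrite -{1}[rev_ord i](permE (@rev_ord_inj n)) permJ permE. Qed.

Lemma rev_permJK n : involutive (fun s : 'S_n => s ^ rev_perm n)%g.
Proof.
move=> s; apply/permP => i; rewrite -{1}[i]rev_ordK rev_permJE.
by rewrite -{1}[i]rev_ordK !(rev_permJE, rev_ordK).
Qed.

Lemma cut_revJ n k (s : 'S_n) : cut k s -> cut (n - k) (s ^ rev_perm n)%g.
Proof.
move=> /cutP cut_s; apply/cutP => i j lt_ij ijk.
rewrite -[i]rev_ordK -[j]rev_ordK !rev_permJE /=.
have lt_s : s (rev_ord j) < s (rev_ord i).
  by apply: cut_s => /=; have := ltn_ord j; have := ltn_ord i; lia.
by have := ltn_ord (s (rev_ord i)); lia.
Qed.

Lemma lo_revJ n k (s : 'S_n) : k <= n -> hi k s -> lo (n - k) (s ^ rev_perm n)%g.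
Proof.
move=> le_kn /forallP hi_s; apply/forallP => i.
rewrite -[i]rev_ordK; move: (rev_ord i) => j; rewrite rev_permJE (inj_eq rev_ord_inj) /=.
apply/implyP => /andP[lt_j lt_s]; apply: (implyP (hi_s j)); move: lt_j lt_s.
have := ltn_ord j; have := ltn_ord (s j); lia.
Qed.

Lemma hi_revJ n k (s : 'S_n) : k <= n -> lo k s -> hi (n - k) (s ^ rev_perm n)%g.
Proof.
move=> le_kn /forallP lo_s; apply/forallP => i.
rewrite -[i]rev_ordK; move: (rev_ord i) => j; rewrite rev_permJE (inj_eq rev_ord_inj) /=.
apply/implyP => /andP[lt_j lt_s]; apply: (implyP (lo_s j)); move: lt_j lt_s.
have := ltn_ord j; have := ltn_ord (s j); lia.
Qed.

Lemma card_cut_hi n k : k <= n ->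
  #|[set s : 'S_n | cut k s && hi k s]| = \sum_(x < (n - k).+1) 'C(k, x).
Proof.
move=> le_kn; have := card_cut_lo (leq_subr k n); rewrite subKn // => <-.
rewrite -(card_preimset _ (inv_inj (@rev_permJK n))).
apply: eq_card => s; rewrite !inE.
apply/andP/andP => [[cut_s hi_s]|[cut_s lo_s]].
  by rewrite -[s]rev_permJK; split; [apply: cut_revJ|apply: lo_revJ].
have := cut_revJ cut_s; have := hi_revJ (leq_subr k n) lo_s.
by rewrite subKn.
Qed.

(** * The sums over [k] *)

Definition binsum (k l : nat) : nat := \sum_(x < k.+1) 'C(l, x).

Lemma binsumS k l : binsum k.+1 l.+1 = binsum k.+1 l + binsum k l.
Proof.
rewrite /binsum big_ord_recl bin0 [in RHS]big_ord_recl bin0 -addnA -big_split /=.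
by congr (_ + _); apply: eq_bigr => x _; rewrite /bump /= add1n binS.
Qed.

Lemma binsum0l l : binsum 0 l = 1.
Proof. by rewrite /binsum big_ord_recl big_ord0 bin0. Qed.

Lemma binsum0r k : binsum k 0 = 1.
Proof. by rewrite /binsum big_ord_recl bin0 big1. Qed.

(** By Pascal's rule the sum plus one satisfies the Fibonacci recurrence, starting from 2 and 3. *)
Lemma binsum_fib n : \sum_(k < n.+1) binsum k (n - k) + 1 = fib (n + 3).
Proof.
pose U m := \sum_(k < m.+1) binsum k (m - k).
(* The two end terms contribute 2; the inner terms give [U m] and [U m.+1] without its term at
   [k = 0], which is 1. *)
have U_rec m : U m.+2 = U m.+1 + U m + 1.
  rewrite /U big_ord_recl binsum0l big_ord_recr /= subnn binsum0r.
  rewrite [\sum_(k < m.+2) _]big_ord_recl binsum0l.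
  under eq_bigr => k _.
    rewrite /= /bump add1n subSS subSn ?binsumS; last by rewrite -ltnS.
    over.
  rewrite big_split /= (eq_bigr (fun k : 'I_m.+1 => binsum k.+1 (m - k))) //; lia.
rewrite -/(U n); have [m] := ubnP n; elim: m n => // m IHm [|[|n]] ltm.
- by rewrite /U big_ord_recl big_ord0 binsum0l.
- by rewrite /U !big_ord_recl big_ord0 binsum0l binsum0r.
rewrite U_rec; have fibS k : fib k.+2 = fib k.+1 + fib k by [].
rewrite (_ : n.+2 + 3 = (n + 3).+2) // fibS -IHm; last lia.
rewrite -addSn -IHm; lia.
Qed.

(** From [n] to [n.+2], the new end terms vanish and each of the [n.+1] inner terms grows by one. *)
Lemma sum_minn_half n : \sum_(k < n.+1) minn k (n - k) = n ^ 2 %/ 4.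
Proof.
have [m] := ubnP n; elim: m n => // m IHm [|[|n]] ltm.
- by rewrite big_ord_recl big_ord0.
- by rewrite !big_ord_recl big_ord0.
rewrite big_ord_recl min0n big_ord_recr /= subnn minn0.
under eq_bigr => k _.
  have le_kn : k <= n by rewrite -ltnS.
  rewrite /= /bump add1n subSS subSn // minnSS -addn1.
  over.
rewrite big_split /= IHm; last lia.
rewrite sum_nat_const card_ord.
have -> : n.+2 ^ 2 = (n + 1) * 4 + n ^ 2 by rewrite -addn2; lia.
by rewrite divnMDl //; lia.
Qed.

(** * Assembling the count *)

Lemma cut_perm1 n k : cut k (1 : 'S_n)%g.
Proof. by apply/cutP => i j; rewrite !perm1. Qed.

Lemma lo_perm1 n k : lo k (1 : 'S_n)%g.
Proof. by apply/forallP => i; rewrite perm1 eqxx implybT. Qed.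

(** The increasing stretches [[0, l)] and [[k, n)] overlap at [k], so [s] increases throughout. *)
Lemma cut_uniq n k l (s : 'S_n) : k < l <= n -> cut k s -> cut l s -> s = 1%g.
Proof.
move=> /andP[lt_kl le_ln] /cutP cut_k /cutP cut_l; apply: (@cut_inj n n).
- apply/cutP => i j lt_ij _; have [le_ki|lt_ik] := leqP k i.
    by rewrite cut_k // le_ki orbT.
  have [lt_jl|le_lj] := ltnP j l; first by rewrite cut_l // lt_jl.
  have lt_kn := leq_trans lt_kl le_ln; pose m := Ordinal lt_kn.
  apply: (@ltn_trans (s m)); first by rewrite cut_l //= lt_kl.
  by rewrite cut_k //= ?leqnn ?orbT // (leq_trans lt_kl).
- exact: cut_perm1.
by apply/setP => v; rewrite -[v](permKV s) mem_first_run ltn_ord -[s _]perm1 mem_first_run ltn_ord.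
Qed.

(** Inclusion-exclusion; the 2 is made of the identity, left out of the set, and the successor in
    [card_cut_lo_hi]. *)
Lemma card_cut_des_sq n k : k <= n ->
  #|[set s : 'S_n | [&& s != 1%g, cut k s & des (s ^+ 2)%g <= 2]]| + minn k (n - k) + 2
    = binsum k (n - k) + binsum (n - k) k.
Proof.
move=> le_kn; rewrite /binsum -card_cut_lo // -card_cut_hi //.
rewrite -cardsUI; set L := _ :|: _; set I := _ :&: _.
have -> : #|I| = (minn k (n - k)).+1.
  by rewrite -card_cut_lo_hi //; apply: eq_card => s; rewrite !inE; do 3!case: (_ k s).
rewrite (cardsD1 1%g L) !inE cut_perm1 lo_perm1 /=.
rewrite (_ : [set s | _] = L :\ 1%g); first by rewrite addn2 add1n addSn addnS.
apply/setP => s; rewrite !inE; case: (boolP (cut k s)) => [cut_s|]; last by rewrite !andbF.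
by rewrite (des_sq_le2 le_kn).
Qed.

(** The identity admits every cut and is counted once; any other permutation counted has exactly one
    cut in [[0, n]]. *)
Lemma card_des_sq n :
  #|[set s : 'S_n | (des s <= 1) && (des (s ^+ 2)%g <= 2)]| =
  1 + \sum_(k < n.+1) #|[set s : 'S_n | [&& s != 1%g, cut k s & des (s ^+ 2)%g <= 2]]|.
Proof.
pose F (k : 'I_n.+1) := [set s : 'S_n | [&& s != 1%g, cut k s & des (s ^+ 2)%g <= 2]].
set X := [set s : 'S_n | _].
have oneX : 1%g \in X.
  rewrite inE (cut_des_le1 (leq0n n) (cut_perm1 n 0)).
  by rewrite (des_sq_le2 (leq0n n) (cut_perm1 n 0)) lo_perm1.
rewrite (cardsD1 1%g X) oneX; congr (_ + _).
have -> : X :\ 1%g = \bigcup_(k : 'I_n.+1) F k.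
  apply/setP => s; rewrite !inE; apply/idP/bigcupP.
    move=> /and3P[ne1 /des_le1_cut[k le_kn cut_s] des2].
    have lt_k : k < n.+1 by [].
    by exists (Ordinal lt_k); rewrite // inE ne1 cut_s.
  move=> [k _]; rewrite inE => /and3P[-> cut_s ->]; rewrite andbT /=.
  by apply: cut_des_le1 cut_s; rewrite -ltnS.
rewrite -sum1_card partition_disjoint_bigcup => [|k l ne_kl].
  by apply: eq_bigr => k _; rewrite sum1_card.
rewrite -setI_eq0; apply/eqP/setP => s; rewrite !inE; apply/negP.
case/andP => /and3P[/eqP ne1 cut_k _] /and3P[_ cut_l _]; apply: ne1.
have [lt_kl|lt_lk|eq_kl] := ltngtP k l.
- by apply: (cut_uniq _ cut_k cut_l); rewrite lt_kl /= -ltnS.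
- by apply: (cut_uniq _ cut_l cut_k); rewrite lt_lk /= -ltnS.
by case/eqP: ne_kl; apply: val_inj.
Qed.

Theorem theorem2p5 (n : nat) (hn : 2 <= n) :
  (#|[set s : 'S_n | (des s <= 1)%N && (des (s ^+ 2)%g <= 2)%N]|%:Z
   = 2 * (fib (n + 3))%:Z - ((n + 4) ^ 2 %/ 4)%N%:Z + 1)%R.
Proof.
rewrite card_des_sq; set S := \sum_(k < n.+1) _.
(* Sum [card_cut_des_sq] over the [n.+1] cuts; the last 2 is twice the 1 of [binsum_fib]. *)
have sum_S : S + n ^ 2 %/ 4 + 2 * n.+1 + 2 = 2 * fib (n + 3).
  have rev_sum : \sum_(k < n.+1) binsum (n - k) k = \sum_(k < n.+1) binsum k (n - k).
    rewrite (reindex_inj rev_ord_inj); apply: eq_bigr => k _ /=.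
    by rewrite subSS subKn // -ltnS.
  have : S + n ^ 2 %/ 4 + n.+1 * 2 = 2 * \sum_(k < n.+1) binsum k (n - k).
    rewrite mul2n -addnn -{2}rev_sum -big_split /=.
    rewrite -(eq_bigr _ (fun (k : 'I_n.+1) _ => card_cut_des_sq (ltn_ord k : k <= n))).
    by rewrite !big_split /= -/S sum_minn_half sum_nat_const card_ord.
  have := binsum_fib n; lia.
(* Here [(n + 4) ^ 2 = (2 * n + 4) * 4 + n ^ 2]. *)
have -> : (n + 4) ^ 2 %/ 4 = (2 * n + 4) + n ^ 2 %/ 4.
  by rewrite -divnMDl //; congr (_ %/ _); lia.
lia.
Qed.
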